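(* Let $\mathbb{K}$ be a commutative field, $U$ and $V$ be $\mathbb{K}$-vector spaces (possibly infinite-dimensional), and $c$ be a positive integer. Let $\mathcal{S}$ be a (finite-dimensional) $c$-LLD linear subspace of $\mathcal{L}(U,V)$, and denote by $\mathcal{S}_F$ the linear subspace of all finite rank operators in $\mathcal{S}$. Then, $\mathcal{S}_F$ is $c$-LLD.
   Context: $\mathcal{L}(U,V)$ is the space of all linear operators from $U$ to $V$. A finite-dimensional linear subspace $\mathcal{S}$ of $\mathcal{L}(U,V)$ is $c$-LLD when, for every $x\in U$, the space $\{f\in\mathcal{S}: f(x)=0\}$ has dimension at least $c$. *)

(* Defs.v *)
From HB Require Import structures.
From mathcomp Require Import all_boot all_order all_algebra.
From mathcomp Require Import boolp classical_sets prodnormedzmodule.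

Set Implicit Arguments.
Unset Strict Implicit.
Unset Printing Implicit Defensive.

Import GRing.Theory.
Local Open Scope classical_set_scope.
Local Open Scope ring_scope.

(* {linear U -> V} as a K-vector space, with pointwise operations. Its
   choiceType structure is the one of prodnormedzmodule. *)
Section LinearOperators.
Variables (K : fieldType) (U V : lmodType K).
Implicit Types f g h : {linear U -> V}.

Lemma linop_eq f g : f =1 g -> f = g.
Proof.
case: f g => [f cf] [g cg] /= /funext fg; rewrite {}fg in cf *.
by congr GRing.Linear.Pack; case: cf cg => [[?] [?]] [[?] [?]];
  congr GRing.Linear.Class; congr (_ _); exact: Prop_irrelevance.
Qed.

Definition linop_zero : {linear U -> V} := \0.
Definition linop_opp f : {linear U -> V} := \- f.
Definition linop_add f g : {linear U -> V} := f \+ g.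
Definition linop_scale (a : K) f : {linear U -> V} := a \*: f.

Let linop_addA : associative linop_add.
Proof. by move=> f g h; apply: linop_eq => x; exact: addrA. Qed.
Let linop_addC : commutative linop_add.
Proof. by move=> f g; apply: linop_eq => x; exact: addrC. Qed.
Let linop_add0 : left_id linop_zero linop_add.
Proof. by move=> f; apply: linop_eq => x; exact: add0r. Qed.
Let linop_addN : left_inverse linop_zero linop_opp linop_add.
Proof. by move=> f; apply: linop_eq => x; exact: addNr. Qed.

HB.instance Definition _ := GRing.isZmodule.Build {linear U -> V}
  linop_addA linop_addC linop_add0 linop_addN.

Let linop_scaleA a b f : linop_scale a (linop_scale b f) = linop_scale (a * b) f.
Proof. by apply: linop_eq => x; exact: scalerA. Qed.
Let linop_scale1 : left_id 1 linop_scale.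
Proof. by move=> f; apply: linop_eq => x; exact: scale1r. Qed.
Let linop_scaleDr : right_distributive linop_scale +%R.
Proof. by move=> a f g; apply: linop_eq => x; exact: scalerDr. Qed.
Let linop_scaleDl f : {morph linop_scale^~ f : a b / a + b}.
Proof. by move=> a b; apply: linop_eq => x; exact: scalerDl. Qed.

HB.instance Definition _ := GRing.Zmodule_isLmodule.Build K {linear U -> V}
  linop_scaleA linop_scale1 linop_scaleDr linop_scaleDl.

Lemma linop_addE f g x : (f + g) x = f x + g x. Proof. by []. Qed.
Lemma linop_scaleE (a : K) f x : (a *: f) x = a *: f x. Proof. by []. Qed.

End LinearOperators.

Section Dimension.
Variables (K : fieldType) (W : lmodType K).

Definition lin_subspace (S : set W) : Prop :=
  S 0 /\ forall (a : K) (u v : W), S u -> S v -> S (a *: u + v).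

Definition lin_span n (e : 'I_n -> W) : set W :=
  [set w | exists a : 'I_n -> K, w = \sum_(i < n) a i *: e i].

Definition lin_indep n (e : 'I_n -> W) : Prop :=
  forall a : 'I_n -> K, \sum_(i < n) a i *: e i = 0 -> forall i, a i = 0.

Definition is_basis n (e : 'I_n -> W) (S : set W) : Prop :=
  lin_indep e /\ S = lin_span e.

Definition has_dim (S : set W) (n : nat) : Prop :=
  exists e : 'I_n -> W, is_basis e S.

Definition fin_dim (S : set W) : Prop := exists n, has_dim S n.

Definition dim_ge (S : set W) (c : nat) : Prop :=
  exists2 n, has_dim S n & (c <= n)%N.

End Dimension.

Section LLD.
Variables (K : fieldType) (U V : lmodType K).

Definition finite_rank (f : {linear U -> V}) : Prop := fin_dim (range f).

Definition LLD (c : nat) (S : set {linear U -> V}) : Prop :=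
  [/\ lin_subspace S, fin_dim S
    & forall x : U, dim_ge [set f | S f /\ f x = 0] c].

Definition finite_rank_part (S : set {linear U -> V}) : set {linear U -> V} :=
  [set f | S f /\ finite_rank f].

End LLD.

(* Main.v *)
(* Let [T] be a complement of the finite-rank part [S_F] in [S]. The common
   kernel [W] of [S_F] has finite codimension, so no nonzero operator of [T] maps
   [W] into a finite-dimensional space. By a form of Amitsur's lemma valid over
   every field, each [x] admits [y] in [W] such that [t |-> t (x + y)] is
   injective on [T] modulo [S_F x]. As [S_F] vanishes at [y], an operator of [S]
   that vanishes at [x + y] lies in [S_F] and vanishes at [x]. *)
Require Import Defs.
From mathcomp Require Import all_boot all_order all_algebra.
From mathcomp Require Import boolp classical_sets.

Set Implicit Arguments.
Unset Strict Implicit.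
Unset Printing Implicit Defensive.

Import GRing.Theory.
Local Open Scope classical_set_scope.
Local Open Scope ring_scope.

(** * Linear algebra modulo a subspace *)

Section Subspaces.
Variables (K : fieldType) (W : lmodType K).
Implicit Types (P A : set W) (u v : W).

(** Linear independence of the classes in [W / P], phrased without forming the quotient. *)
Definition indep_mod P n (e : 'I_n -> W) : Prop :=
  forall a : 'I_n -> K, P (\sum_(i < n) a i *: e i) -> forall i, a i = 0.

Lemma lin_subspaceD P u v : lin_subspace P -> P u -> P v -> P (u + v).
Proof. by move=> [_ PD] Pu Pv; have := PD 1 _ _ Pu Pv; rewrite scale1r. Qed.

Lemma lin_subspaceZ P a u : lin_subspace P -> P u -> P (a *: u).
Proof. by move=> [P0 PD] Pu; have := PD a _ _ Pu P0; rewrite addr0. Qed.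

Lemma lin_subspaceB P u v : lin_subspace P -> P u -> P v -> P (u - v).
Proof.
move=> sP Pu Pv; apply: lin_subspaceD => //.
by rewrite -scaleN1r; apply: lin_subspaceZ.
Qed.

Lemma lin_subspace_sum P n (a : 'I_n -> K) (e : 'I_n -> W) :
  lin_subspace P -> (forall i, P (e i)) -> P (\sum_(i < n) a i *: e i).
Proof.
move=> sP Pe; apply: (big_ind P); first by case: sP.
  by move=> u v; apply: lin_subspaceD.
by move=> i _; apply: lin_subspaceZ.
Qed.

Lemma lin_subspace_span n (e : 'I_n -> W) : lin_subspace (lin_span e).
Proof.
split; first by exists (fun=> 0); rewrite big1 // => i _; rewrite scale0r.
move=> a _ _ [b ->] [c ->]; exists (fun i => a * b i + c i).
rewrite scaler_sumr -big_split /=; apply: eq_bigr => i _.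
by rewrite scalerDl scalerA.
Qed.

Lemma lin_span_basis n (e : 'I_n -> W) i : lin_span e (e i).
Proof.
exists (fun j => (j == i)%:R); rewrite (bigD1 i) //= eqxx scale1r big1 ?addr0 //.
by move=> j /negbTE->; rewrite scale0r.
Qed.

Lemma lin_span_sub P n (e : 'I_n -> W) :
  lin_subspace P -> (forall i, P (e i)) -> lin_span e `<=` P.
Proof. by move=> sP Pe _ [a ->]; apply: lin_subspace_sum. Qed.

(** Used to let a finite-dimensional space absorb finitely many further vectors; concatenation
    suffices, since spanning families may be redundant. *)
Lemma lin_span_extend n (e : 'I_n -> W) m (v : 'I_m -> W) :
  exists k, exists2 e' : 'I_k -> W,
    lin_span e `<=` lin_span e' & forall i, lin_span e' (v i).
Proof.
pose e' (i : 'I_(n + m)) :=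
  match split i with inl j => e j | inr j => v j end.
have e'l j : e' (lshift m j) = e j by rewrite /e' (unsplitK (inl j)).
have e'r j : e' (rshift n j) = v j by rewrite /e' (unsplitK (inr j)).
exists (n + m)%N, e' => [|i]; last by rewrite -e'r; apply: lin_span_basis.
apply: lin_span_sub; first exact: lin_subspace_span.
by move=> i; rewrite -e'l; apply: lin_span_basis.
Qed.

(** If [n < m], the matrix of coordinates of [v] along [e] has a nonzero left kernel, whose rows are
    dependency relations between the [v i]. *)
Lemma lin_indep_leq n (e : 'I_n -> W) m (v : 'I_m -> W) :
  lin_indep v -> (forall i, lin_span e (v i)) -> (m <= n)%N.
Proof.
move=> indv /choice[M vE]; pose B : 'M[K]_(m, n) := \matrix_(i, j) M i j.
rewrite leqNgt; apply/negP => ltnm.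
have /eqP : kermx B != 0.
  rewrite -mxrank_eq0 mxrank_ker subn_eq0 -ltnNge.
  exact: leq_ltn_trans (rank_leq_col B) ltnm.
apply; apply/matrixP => r i; rewrite [RHS]mxE.
apply: (indv (fun i => kermx B r i)).
under eq_bigr do rewrite vE scaler_sumr.
rewrite exchange_big big1 // => j _.
transitivity ((kermx B *m B) r j *: e j); last by rewrite mulmx_ker mxE scale0r.
by rewrite mxE scaler_suml; apply: eq_bigr => k _; rewrite scalerA [B k j]mxE.
Qed.

(** As the tail is independent, a nontrivial relation modulo [P] has a nonzero coefficient at
    [ord0], by which it can be divided. *)
Lemma not_indep_mod_recl P n (e : 'I_n.+1 -> W) :
    lin_subspace P -> indep_mod P (fun i => e (lift ord0 i)) ->
    ~ indep_mod P e ->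
  exists b : 'I_n -> K, P (e ord0 - \sum_(i < n) b i *: e (lift ord0 i)).
Proof.
move=> sP inde nind; apply: contrapT => nb; apply: nind => a.
rewrite big_ord_recl => Pa; have a0 : a ord0 = 0.
  apply/eqP/negPn/negP => a0; apply: nb.
  exists (fun i => - (a ord0)^-1 * a (lift ord0 i)).
  have := lin_subspaceZ (a ord0)^-1 sP Pa.
  rewrite scalerDr scalerA mulVf // scale1r scaler_sumr -sumrN.
  congr (P (_ + _)); apply: eq_bigr => i _.
  by rewrite scalerA mulNr scaleNr opprK.
move: Pa; rewrite a0 scale0r add0r => /(inde (fun i => a (lift ord0 i))) al0 i.
by case: (unliftP ord0 i) => [j|] ->.
Qed.

(** Independence modulo [P] implies independence, so [n] bounds the size of such families in [A]; a
    vector not reducible along a largest one would extend it. *)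
Lemma exists_max_indep_mod P A n (e : 'I_n -> W) :
    lin_subspace P -> A `<=` lin_span e ->
  exists k (g : 'I_k -> W), [/\ forall i, A (g i), indep_mod P g
    & forall v, A v -> exists a : 'I_k -> K, P (v - \sum_(i < k) a i *: g i)].
Proof.
move=> sP Ae.
pose fam k := `[< exists g : 'I_k -> W, (forall i, A (g i)) /\ indep_mod P g >].
have fam0 : exists k, fam k.
  by exists 0%N; apply/asboolP; exists (fun=> 0); split=> [[]|a _ []].
have famn k : fam k -> (k <= n)%N.
  move=> /asboolP[g [Ag indg]]; apply: (lin_indep_leq (e := e) (v := g)).
    by move=> a a0; apply: indg; rewrite a0; case: sP.
  by move=> i; apply: Ae.
case: (ex_maxnP fam0 famn) => k /asboolP[g [Ag indg]] kmax.
exists k, g; split=> // v Av; apply: contrapT => nv.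
suff /kmax : fam k.+1 by rewrite ltnn.
pose g' i := oapp g v (unlift ord0 i).
have g'l : (fun i => g' (lift ord0 i)) = g.
  by apply: funext => i; rewrite /g' liftK.
apply/asboolP; exists g'; split=> [i|].
  by rewrite /g'; case: unliftP => [j|] _ /=.
apply: contrapT => /not_indep_mod_recl; rewrite g'l => /(_ sP indg)[a].
by rewrite {1}/g' unlift_none /= => Pa; apply: nv; exists a; rewrite -g'l.
Qed.

Lemma subspace_has_dim A n (e : 'I_n -> W) :
  lin_subspace A -> A `<=` lin_span e -> fin_dim A.
Proof.
move=> sA Ae.
have s0 : lin_subspace [set (0 : W)].
  by split=> // a u v -> ->; rewrite /= scaler0 addr0.
have [k [g [Ag indg spg]]] := exists_max_indep_mod s0 Ae.
exists k, g; split=> //; apply/seteqP; split; last exact: lin_span_sub.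
by move=> v /spg[a /eqP]; rewrite subr_eq0 => /eqP ->; exists a.
Qed.

Lemma dim_ge_sub P A c : P `<=` A -> fin_dim A -> dim_ge P c -> dim_ge A c.
Proof.
move=> PA [n [e [inde Ae]]] [m [v [indv Pv]] cm]; exists n; first by exists e.
rewrite {}Ae {}Pv in PA.
apply: leq_trans cm _; apply: lin_indep_leq indv _ => i.
by apply: PA; apply: lin_span_basis.
Qed.

End Subspaces.

(** * Separation by a single point *)

Section Separation.
Variables (K : fieldType) (U V : lmodType K).

(* Suppose separation fails for [n.+1] operators and choose [w] where the last
   [n] are independent mod [P]. For [y] generic, the dependency relations at
   [x + y] and [x + w + y] have the same coefficients, so their difference is a
   relation at [w]; hence these coefficients do not depend on [y], and the
   corresponding combination maps [W] into the finite-dimensional space [Q]. *)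
Lemma exists_separating_point (W : set U) n (g : 'I_n -> {linear U -> V}) :
    lin_subspace W ->
    (forall (a : 'I_n -> K) k (e : 'I_k -> V),
       (forall y, W y -> lin_span e (\sum_(i < n) a i *: g i y)) ->
       forall i, a i = 0) ->
  forall k (e : 'I_k -> V) x,
    exists2 y, W y & indep_mod (lin_span e) (fun i => g i (x + y)).
Proof.
move=> sW; elim: n g => [|n IHn] g ginf k e x.
  by exists 0; [case: sW | move=> a _ []].
pose g' i := g (lift ord0 i).
have {}IHn l (e' : 'I_l -> V) z :
    exists2 y, W y & indep_mod (lin_span e') (fun i => g' i (z + y)).
  apply: IHn => a m f af i.
  (* A combination of the last [n] operators is one of all of them with coefficient 0 at [ord0], so
     the tail inherits [ginf]. *)
  pose a' i := oapp a 0 (unlift ord0 i).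
  suff : a' (lift ord0 i) = 0 by rewrite /a' liftK.
  apply: (ginf a' m f) => y Wy.
  rewrite big_ord_recl {1}/a' unlift_none scale0r add0r.
  by under eq_bigr do rewrite /a' liftK; apply: af.
apply: contrapT => nsep.
have [w Ww] := IHn _ e 0; rewrite add0r => indw.
(* [Q] contains [P] and all values at [x] and [w], so translating by [x] or [x + w] does not affect
   independence modulo [Q]. Generic means that the tail at [y] is independent modulo [Q]. *)
have [q1 [f1 ef1 f1x]] := lin_span_extend e (fun i => g i x).
have [q [f f1f fw]] := lin_span_extend f1 (fun i => g i w).
set P := lin_span e in ef1 indw; set Q := lin_span f in f1f fw.
have sP : lin_subspace P by apply: lin_subspace_span.
have sQ : lin_subspace Q by apply: lin_subspace_span.
have PQ : P `<=` Q by apply: subset_trans f1f.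
have fx i : Q (g i x) by apply: f1f.
pose rel z (b : 'I_n -> K) := g ord0 z - \sum_(i < n) b i *: g' i z.
have relD b z t : rel (z + t) b = rel z b + rel t b.
  rewrite /rel raddfD addrACA -opprD -big_split /=.
  by congr (_ - _); apply: eq_bigr => i _; rewrite raddfD scalerDr.
have relQ b z : (forall i, Q (g i z)) -> Q (rel z b).
  move=> gz; apply: lin_subspaceB => //.
  by apply: lin_subspace_sum => // i; apply: gz.
have uniq_rel A b c z : lin_subspace A -> indep_mod A (g'^~ z) ->
    A (rel z b) -> A (rel z c) -> b = c.
  move=> sA indz Ab Ac; apply: funext => i; apply/eqP.
  rewrite -subr_eq0; apply/eqP; apply: (indz (fun i => b i - c i)).
  have -> : \sum_(i < n) (b i - c i) *: g' i z = rel z c - rel z b.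
    rewrite /rel opprB addrC addrA subrK -sumrB.
    by apply: eq_bigr => j _; rewrite scalerBl.
  exact: lin_subspaceB.
have sum_shift (a : 'I_n -> K) z t : \sum_(i < n) a i *: g' i t =
    \sum_(i < n) a i *: g' i (z + t) - \sum_(i < n) a i *: g' i z.
  rewrite -sumrB; apply: eq_bigr => j _.
  by rewrite -scalerBr [g' j (z + t)]raddfD addrAC subrr add0r.
have genP y z : (forall i, Q (g i z)) -> indep_mod Q (g'^~ y) ->
    indep_mod P (g'^~ (z + y)).
  move=> Qz indy a /PQ Qa; apply: indy.
  rewrite (sum_shift a z); apply: lin_subspaceB => //.
  by apply: lin_subspace_sum => // i; apply: Qz.
have ex_rel y t : W y -> W t -> (forall i, Q (g i t)) ->
    indep_mod Q (g'^~ y) -> exists b, P (rel (x + t + y) b).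
  move=> Wy Wt Qt indy.
  (* The tail is independent by [genP]; were the whole family so, [t + y] would be a separating
     point. *)
  apply: (not_indep_mod_recl (e := fun i => g i (x + t + y))) => //.
    apply: genP => // i; rewrite raddfD.
    by apply: lin_subspaceD (fx i) (Qt i).
  move=> ind; apply: nsep; exists (t + y); first exact: lin_subspaceD.
  by rewrite addrA.
have W0 : W 0 by case: sW.
have g0 i : Q (g i 0) by rewrite raddf0; case: sQ.
have gen_rel y : W y -> indep_mod Q (g'^~ y) ->
    exists2 b, P (rel w b) & Q (rel y b).
  move=> Wy indy.
  have [b Pb] := ex_rel y 0 Wy W0 g0 indy; rewrite addr0 in Pb.
  have [c Pc] := ex_rel y w Wy Ww fw indy.
  have Qb : Q (rel y b).
    have -> : rel y b = rel (x + y) b - rel x b.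
      by rewrite relD addrAC subrr add0r.
    by apply: lin_subspaceB => //; [apply: PQ | apply: relQ].
  have Qc : Q (rel y c).
    have -> : rel y c = rel (x + w + y) c - rel (x + w) c.
      by rewrite relD addrAC subrr add0r.
    apply: lin_subspaceB => //; first exact: PQ.
    by apply: relQ => i; rewrite raddfD; apply: lin_subspaceD (fx i) (fw i).
  exists b => //.
  have bc := uniq_rel _ _ _ _ sQ indy Qb Qc; rewrite -{}bc in Pc.
  have -> : rel w b = rel (x + w + y) b - rel (x + y) b.
    by rewrite !relD opprD addrACA subrr addr0 addrAC subrr add0r.
  exact: lin_subspaceB.
have [y0 Wy0] := IHn _ f 0; rewrite add0r => indy0.
have [b Pb _] := gen_rel y0 Wy0 indy0.
(* Relations at [w] modulo [P] are unique, so the [b] found at [y0] serves every generic [y]. *)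
have {}gen_rel y : W y -> indep_mod Q (g'^~ y) -> Q (rel y b).
  by move=> Wy /(gen_rel y Wy)[c Pc]; rewrite (uniq_rel _ _ _ _ sP indw Pb Pc).
have relW y : W y -> Q (rel y b).
  (* An arbitrary [y] is the difference of the generic points [y + t] and [t], with [t] generic even
     after the values at [y] are added to [Q]. *)
  move=> Wy; have [m [h Qh hy]] := lin_span_extend f (fun i => g i y).
  have [t Wt] := IHn _ h 0; rewrite add0r => indt.
  have -> : rel y b = rel (y + t) b - rel t b by rewrite relD addrK.
  have indQ z : (forall i, lin_span h (g i z)) -> indep_mod Q (g'^~ (z + t)).
    move=> hz a /Qh ha; apply: indt.
    have sh := lin_subspace_span h.
    rewrite (sum_shift a z); apply: lin_subspaceB => //.
    by apply: lin_subspace_sum => // i; apply: hz.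
  apply: lin_subspaceB => //; apply: gen_rel => //.
  - exact: lin_subspaceD.
  - exact: indQ.
  - rewrite -[t]add0r; apply: indQ => i; rewrite raddf0.
    by case: (lin_subspace_span h).
pose a i := oapp (fun j => - b j) 1 (unlift (ord0 : 'I_n.+1) i).
suff : a ord0 = 0 by rewrite /a unlift_none => /eqP; rewrite oner_eq0.
apply: (ginf a _ f) => y /relW; congr (Q _).
rewrite /rel big_ord_recl {1}/a unlift_none scale1r -sumrN; congr (_ + _).
by apply: eq_bigr => i _; rewrite /a liftK scaleNr.
Qed.

End Separation.

(** * Finite-rank operators and their common kernels *)

Section FiniteRank.
Variables (K : fieldType) (U V : lmodType K).
Implicit Types (f h : {linear U -> V}) (S : set {linear U -> V}) (W : set U).

Lemma lin_subspace_image f W : lin_subspace W -> lin_subspace (f @` W).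
Proof.
move=> [W0 WD]; split; first by exists 0; rewrite ?raddf0.
move=> a _ _ [x Wx <-] [y Wy <-].
by exists (a *: x + y); [apply: WD | rewrite linearP].
Qed.

Lemma finite_rankP f :
  finite_rank f <-> exists k (e : 'I_k -> V), forall x, lin_span e (f x).
Proof.
split=> [[k [e [_ fe]]]|[k [e fe]]].
  by exists k, e => x; rewrite -fe; exists x.
apply: (subspace_has_dim (e := e)); first exact: lin_subspace_image.
by move=> _ [x _ <-].
Qed.

Lemma finite_rank_part_subspace S :
  lin_subspace S -> lin_subspace (finite_rank_part S).
Proof.
move=> [S0 SD]; split.
  split=> //; apply/finite_rankP; exists 0%N, (fun=> 0) => x.
  by exists (fun=> 0); rewrite big_ord0.
move=> a f h [Sf /finite_rankP[k [e fe]]] [Sh /finite_rankP[l [e' he']]].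
split; first exact: SD.
have [m [e2 ee2 e2e']] := lin_span_extend e e'.
apply/finite_rankP; exists m, e2 => x; have s2 := lin_subspace_span e2.
rewrite linop_addE linop_scaleE.
apply: lin_subspaceD => //; first by apply: lin_subspaceZ => //; apply: ee2.
exact: lin_span_sub s2 e2e' _ (he' x).
Qed.

Lemma span_image_ker f h W k (e : 'I_k -> V) :
    finite_rank f -> lin_subspace W ->
    (forall y, W y -> f y = 0 -> lin_span e (h y)) ->
  exists l (e' : 'I_l -> V), forall y, W y -> lin_span e' (h y).
Proof.
move=> /finite_rankP[m [v fv]] sW he.
have [||d [b [_ Wb]]] := subspace_has_dim (A := f @` W) (e := v).
- exact: lin_subspace_image.
- by move=> _ [x _ <-].
have /choice[u ub] i : exists u, W u /\ f u = b i.
  have : (f @` W) (b i) by rewrite Wb; apply: lin_span_basis.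
  by case=> u Wu <-; exists u.
have [l [e' ee' e'u]] := lin_span_extend e (fun i => h (u i)).
exists l, e' => y Wy; have s' := lin_subspace_span e'.
have [a fy] : lin_span b (f y) by rewrite -Wb; exists y.
pose z := \sum_(i < d) a i *: u i.
have fz : f z = f y.
  by rewrite fy linear_sum; apply: eq_bigr => i _; rewrite linearZZ (ub i).2.
have Wz : W z by apply: lin_subspace_sum => // i; case: (ub i).
have -> : h y = h (y - z) + h z by rewrite -raddfD subrK.
apply: lin_subspaceD => //.
  apply/ee'/he; first exact: lin_subspaceB.
  by rewrite linearB fz subrr.
rewrite linear_sum; apply: (big_ind (lin_span e')); first by case: s'.
  by move=> ? ?; apply: lin_subspaceD.
by move=> i _; rewrite linearZZ; apply: lin_subspaceZ.
Qed.

Definition common_ker m (f : 'I_m -> {linear U -> V}) : set U :=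
  [set y | forall i, f i y = 0].

Lemma lin_subspace_common_ker m (f : 'I_m -> {linear U -> V}) :
  lin_subspace (common_ker f).
Proof.
split=> [i|a x y fx fy i]; first exact: raddf0.
by rewrite linearP fx fy scaler0 addr0.
Qed.

(** The conditions [f i y = 0] are dropped one at a time by [span_image_ker], until the common
    kernel is all of [U]. *)
Lemma finite_rank_common_ker m (f : 'I_m -> {linear U -> V}) h k
    (e : 'I_k -> V) :
    (forall i, finite_rank (f i)) ->
    (forall y, common_ker f y -> lin_span e (h y)) ->
  finite_rank h.
Proof.
move=> ff fh; apply/finite_rankP.
elim: m => [|m IHm] in f k e ff fh *.
  by exists k, e => x; apply: fh => -[].
pose f' i := f (lift ord0 i).
have [|l [e' fh']] := span_image_ker (f := f ord0) (h := h) (e := e)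
  (ff ord0) (lin_subspace_common_ker f').
  move=> y f'y f0; apply: fh => i.
  by case: (unliftP ord0 i) => [j|] ->; [apply: f'y|].
by apply: IHm fh' => i; apply: ff.
Qed.

Lemma linop_sumE n (a : 'I_n -> K) (g : 'I_n -> {linear U -> V}) x :
  (\sum_(i < n) a i *: g i : {linear U -> V}) x = \sum_(i < n) a i *: g i x.
Proof. by elim/big_rec2: _ => // i _ f _ <-. Qed.

End FiniteRank.

(** * Transfer of the kernel bound from [x + y] to [x] *)

Theorem proposition3p10 (K : fieldType) (U V : lmodType K) (c : nat)
    (S : set {linear U -> V}) :
  (0 < c)%N -> LLD c S -> LLD c (finite_rank_part S).
Proof.
move=> _ [sS [N [b [_ Sb]]] Sc].
have SbN : S `<=` lin_span b by rewrite Sb.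
have sF := finite_rank_part_subspace sS.
have FS : finite_rank_part S `<=` S by move=> f [].
have dF : fin_dim (finite_rank_part S).
  by apply: subspace_has_dim sF _; apply: subset_trans SbN.
split=> // x; have [m [f [_ Ff]]] := dF.
have Fk i : finite_rank_part S (f i) by rewrite Ff; apply: lin_span_basis.
have [k [g [Sg indg spg]]] := exists_max_indep_mod sF SbN.
have sW := lin_subspace_common_ker f.
have [|y Wy indy] := exists_separating_point (g := g) sW _ (fun i => f i x) x.
  (* A combination of [g] sending the common kernel into a finite-dimensional space has finite rank,
     so it is 0 modulo the finite-rank part. *)
  move=> a l e ae; apply: indg; split; first exact: lin_subspace_sum.
  apply: (finite_rank_common_ker (f := f) (e := e)) => [i|z Wz].
    by case: (Fk i).
  by rewrite linop_sumE; apply: ae.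
apply: dim_ge_sub (Sc (x + y)).
  move=> h [Sh hxy]; have [a Fs] := spg h Sh.
  set t := \sum_(i < k) a i *: g i in Fs.
  have [d sd] : lin_span f (h - t) by rewrite -Ff.
  (* [h - t] is a combination of the [f i], all of which vanish at [y]. *)
  have sxy : (h - t) (x + y) = (h - t) x.
    rewrite [LHS]linearD [X in _ + X](_ : _ = 0) ?addr0 //.
    by rewrite sd linop_sumE big1 // => i _; rewrite Wy scaler0.
  (* From [h (x + y) = 0], [t (x + y)] lies in the span of the [f i x], modulo which the
     [g i (x + y)] are independent. *)
  have a0 : forall i, a i = 0.
    apply: indy; rewrite -linop_sumE -/t.
    have -> : t (x + y) = - (h - t) x.
      by rewrite -sxy linop_addE hxy add0r opprK.
    rewrite sd linop_sumE -sumrN; exists (fun i => - d i).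
    by apply: eq_bigr => i _; rewrite scaleNr.
  have t0 : t = 0 by rewrite /t big1 // => i _; rewrite a0 scale0r.
  rewrite t0 subr0 in Fs sxy.
  by split; [| rewrite /= -sxy].
apply: (subspace_has_dim (e := b)); last by move=> h [/FS/SbN].
split; first by split=> //; case: sF.
move=> a p q [Fp px] [Fq qx]; split; first by case: sF => _; apply.
by rewrite linop_addE linop_scaleE px qx scaler0 addr0.
Qed.
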